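(* (Multiple samples.) Let $n,l\ge 1$, $F\in\mathcal{L}_{2^n\times 2^n}$, $H\in\mathcal{L}_{2^l\times 2^n}$, and consider the Boolean network $$x(t+1)=Fx(t),\qquad y(t)=Hx(t),\qquad t\in\mathbb{N},$$ with $x(t)\in\Delta_{2^n}$, $y(t)\in\Delta_{2^l}$. If this Boolean network is observable, then it is uniquely identifiable from sufficient multiple-sample data. That is: if $F'\in\mathcal{L}_{2^n\times 2^n}$ and $H'\in\mathcal{L}_{2^l\times 2^n}$ are such that the Boolean network $(F',H')$ generates all the available data of $(F,H)$, then there is a $2^n\times 2^n$ permutation matrix $G$ with $F'=GFG^{\mathrm T}$ and $H'=HG^{\mathrm T}$.
   Context: Notation: $\mathbb{N}=\{0,1,2,\dots\}$; $\delta_k^i$ is the $i$-th column of the identity matrix $I_k$; $\Delta_k=\{\delta_k^1,\dots,\delta_k^k\}$; $\mathcal{L}_{p\times q}$ is the set of real $p\times q$ matrices all of whose columns lie in $\Delta_p$. Observability: the Boolean network $(F,H)$ is observable if any two distinct initial states $x(0)\ne\bar x(0)$ in $\Delta_{2^n}$ generate distinct output sequences, i.e. $(Hx(0),HFx(0),HF^2x(0),\dots)\neq(H\bar x(0),HF\bar x(0),HF^2\bar x(0),\dots)$. Available data (multiple samples, sufficient data): the output sequences recorded from (unknown) different initial states; the data are assumed sufficient, meaning that they contain everything the system can generate. So the available data of $(F,H)$ is the set of all output sequences $(HF^tx_0)_{t\in\mathbb{N}}$, $x_0\in\Delta_{2^n}$, not labelled by the states. A Boolean network $(F',H')$ generates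 these data if for every $x_0\in\Delta_{2^n}$ there is $x_0'\in\Delta_{2^n}$ with $H'(F')^tx_0'=HF^tx_0$ for all $t\in\mathbb{N}$. Unique identifiability: $F,H$ are determined by the available data up to a coordinate change $\omega=Gx$ of the state ($G$ a permutation matrix), under which $(F,H)$ becomes $(GFG^{\mathrm T},HG^{\mathrm T})$. The dimensions $n,l$ are known. *)

(* Defs.v *)
(* MathComp; the scalars are an abstract realType, i.e. the real numbers. *)
From mathcomp Require Import all_boot all_order all_algebra.
From mathcomp Require Import reals.

Set Implicit Arguments.
Unset Strict Implicit.
Unset Printing Implicit Defensive.

Import GRing.Theory.
Local Open Scope ring_scope.

(* Columns are indexed from 0: [delta i] is the column usually written
   delta_k^(i+1). *)
Definition delta (R : realType) (k : nat) (i : 'I_k) : 'cV[R]_k :=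
  col i 1%:M.

Definition in_Delta (R : realType) (k : nat) (x : 'cV[R]_k) : Prop :=
  exists i : 'I_k, x = delta R i.

Definition logical_mx (R : realType) (p q : nat) (A : 'M[R]_(p, q)) : Prop :=
  forall j : 'I_q, in_Delta (col j A).

(* y(t) = H F^t x(0), the output at time t of x(t+1) = F x(t), y(t) = H x(t). *)
Definition output (R : realType) (N q : nat) (F : 'M[R]_N) (H : 'M[R]_(q, N))
    (x0 : 'cV[R]_N) : nat -> 'cV[R]_q :=
  fun t => H *m F ^+ t *m x0.

Definition observable (R : realType) (N q : nat)
    (F : 'M[R]_N) (H : 'M[R]_(q, N)) : Prop :=
  forall x0 x1 : 'cV[R]_N, in_Delta x0 -> in_Delta x1 -> x0 <> x1 ->
    ~ (output F H x0 =1 output F H x1).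

(* Sufficient multiple-sample data: the unlabelled set of all the output
   sequences that the network produces. *)
Definition available_data (R : realType) (N q : nat)
    (F : 'M[R]_N) (H : 'M[R]_(q, N)) (y : nat -> 'cV[R]_q) : Prop :=
  exists2 x0 : 'cV[R]_N, in_Delta x0 & y =1 output F H x0.

Definition generates_data (R : realType) (N q : nat)
    (F' : 'M[R]_N) (H' : 'M[R]_(q, N)) (data : (nat -> 'cV[R]_q) -> Prop) :
    Prop :=
  forall y, data y -> exists2 x0' : 'cV[R]_N, in_Delta x0' &
    output F' H' x0' =1 y.

Definition uniquely_identifiable (R : realType) (N q : nat)
    (F : 'M[R]_N) (H : 'M[R]_(q, N)) : Prop :=
  forall (F' : 'M[R]_N) (H' : 'M[R]_(q, N)),
    logical_mx F' -> logical_mx H' ->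
    generates_data F' H' (available_data F H) ->
    exists G : 'M[R]_N,
      [/\ is_perm_mx G, F' = G *m F *m G^T & H' = H *m G^T].

(* Main.v *)
(* Matching each state of (F, H) with a state of (F', H') that has the same
   output sequence is injective by observability, hence a permutation s of the
   states.  Dropping the first output shows that the successor of s j under F'
   has the output sequence of the successor of j under F, so by observability
   again s intertwines F with F'; comparing the first outputs, it intertwines
   H with H'. *)
Require Import Defs.
From mathcomp Require Import all_boot all_order all_algebra.
From mathcomp Require Import all_fingroup.
From mathcomp Require Import reals.

Set Implicit Arguments.
Unset Strict Implicit.
Unset Printing Implicit Defensive.

Import GRing.Theory.
Local Open Scope ring_scope.

Lemma mulmx_delta (R : realType) (p q : nat) (A : 'M[R]_(p, q)) (j : 'I_q) :
  A *m delta R j = col j A.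
Proof. by rewrite /delta !colE mul1mx. Qed.

Lemma eq_mulmx_delta (R : realType) (p q : nat) (A B : 'M[R]_(p, q)) :
  (forall j, A *m delta R j = B *m delta R j) -> A = B.
Proof.
move=> eqAB; apply/matrixP=> i j.
by have /colP/(_ i) := eqAB j; rewrite !mulmx_delta !mxE.
Qed.

Lemma logical_mx_fun (R : realType) (p q : nat) (A : 'M[R]_(p, q)) :
  logical_mx A -> exists f : 'I_q -> 'I_p,
    forall j, A *m delta R j = delta R (f j).
Proof.
move=> logA.
apply: (fin_all_exists (P := fun j i => A *m delta R j = delta R i)) => j.
by have [i Ai] := logA j; exists i; rewrite mulmx_delta.
Qed.

(** The inverse comes from the convention for [perm_mx]: the entry of [perm_mx s] at [(i, j)] is 1
    when [s i = j], so on columns it acts by the inverse of [s]. *)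
Lemma perm_mxV_delta (R : realType) (k : nat) (s : 'S_k) (j : 'I_k) :
  perm_mx s^-1 *m delta R j = delta R (s j).
Proof.
rewrite mulmx_delta; apply/colP=> i.
by rewrite !mxE (canF_eq (permKV s)).
Qed.

Lemma output0 (R : realType) (N q : nat) (F : 'M[R]_N) (H : 'M[R]_(q, N)) x :
  output F H x 0%N = H *m x.
Proof. by rewrite /output expr0 mulmx1. Qed.

Lemma outputS (R : realType) (N q : nat) (F : 'M[R]_N) (H : 'M[R]_(q, N)) x t :
  output F H (F *m x) t = output F H x t.+1.
Proof. by rewrite /output exprSr -!mulmxA. Qed.

Lemma observable_delta_inj (R : realType) (N q : nat)
    (F : 'M[R]_N) (H : 'M[R]_(q, N)) (i j : 'I_N) :
  observable F H ->
  output F H (delta R i) =1 output F H (delta R j) -> i = j.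
Proof.
move=> obs eq_out; apply/eqP/negPn/negP => neq_ij.
apply: (obs (delta R i) (delta R j)) => //; [by exists i | by exists j |].
(* At row [i] the two columns have entries 1 and 0. *)
move/colP/(_ i); rewrite !mxE eqxx (negPf neq_ij) => /eqP.
by rewrite oner_eq0.
Qed.

Lemma observable_uniquely_identifiable (R : realType) (N q : nat)
    (F : 'M[R]_N) (H : 'M[R]_(q, N)) :
  logical_mx F -> observable F H -> uniquely_identifiable F H.
Proof.
move=> /logical_mx_fun [f Ff] obs F' H' /logical_mx_fun [f' F'f'] _ gen.
have [g gP] : exists g : 'I_N -> 'I_N, forall j,
    output F' H' (delta R (g j)) =1 output F H (delta R j).
  apply: (fin_all_exists (P := fun j i =>
    output F' H' (delta R i) =1 output F H (delta R j))) => j.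
  have [|_ [i ->] eq_out] := gen (output F H (delta R j)); last by exists i.
  by exists (delta R j) => //; exists j.
have g_inj : injective g.
  move=> i j eq_g; apply: (observable_delta_inj obs) => t.
  by rewrite -!gP eq_g.
pose s := perm g_inj.
have sP j : output F' H' (delta R (s j)) =1 output F H (delta R j).
  by move=> t; rewrite permE gP.
have f's j : f' (s j) = s (f j).
  (* Observability is given for [(F, H)], so [f' (s j)] is first pulled back along [s]; [sP] then
     carries the comparison over to [(F', H')]. *)
  apply: (canRL (permKV s)); apply: (observable_delta_inj obs) => t.
  by rewrite -sP permKV -F'f' -Ff !outputS sP.
have GK : perm_mx s^-1 *m perm_mx s = 1%:M :> 'M[R]_N.
  by rewrite -perm_mxM mulVg perm_mx1.
exists (perm_mx s^-1); rewrite tr_perm_mx invgK; split.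
- exact: perm_mx_is_perm.
(* Cancelling [perm_mx s] on the right leaves an intertwining relation, which can be checked on the
   columns [delta R j]. *)
- suff <- : F' *m perm_mx s^-1 = perm_mx s^-1 *m F by rewrite -mulmxA GK mulmx1.
  apply: eq_mulmx_delta => j.
  by rewrite -!mulmxA Ff !perm_mxV_delta F'f' f's.
- suff <- : H' *m perm_mx s^-1 = H by rewrite -mulmxA GK mulmx1.
  apply: eq_mulmx_delta => j.
  (* Both sides are outputs at time 0, where [sP] applies. *)
  by rewrite -mulmxA perm_mxV_delta -(output0 F') sP output0.
Qed.

Theorem theorem3p4 (R : realType) (n l : nat)
    (F : 'M[R]_(2 ^ n)%N) (H : 'M[R]_((2 ^ l)%N, (2 ^ n)%N)) :
  (1 <= n)%N -> (1 <= l)%N ->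
  logical_mx F -> logical_mx H ->
  observable F H -> uniquely_identifiable F H.
Proof. by move=> _ _ logF _; apply: observable_uniquely_identifiable. Qed.
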